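(* Let $0<q<1$ and let $w:(0,1]\to(0,\infty)$ be a function such that $\sum_{k=0}^\infty q^k w(q^k)<\infty$. Let $p_n(x)=\gamma_n x^n+\cdots$ ($\gamma_n>0$, $n=0,1,2,\ldots$) be the orthonormal polynomials on the lattice $\{q^k : k=0,1,2,\ldots\}$ with weight $w$, i.e. \[ \sum_{k=0}^\infty p_n(q^k)p_m(q^k)\,q^k w(q^k)=\delta_{n,m},\qquad n,m\ge 0, \] and let $x_{1,n}<x_{2,n}<\cdots<x_{n,n}$ be the zeros of $p_n$ (which are simple and lie in $(0,1)$). Suppose that \[ \lim_{n\to\infty}\frac{1}{n^2}\log w(x^n)=0 \] uniformly for $x$ in every closed interval $[a,b]$ with $0<a<b\le 1$. Then \[ \lim_{n\to\infty}\gamma_n^{1/n^2}=q^{-1/2}, \] and the asymptotic distribution of the roots $x_{1,n}^{1/n}<\cdots<x_{n,n}^{1/n}$ is given by the measure $\nu^\sigma$ on $[q,1]$ with density \[ (\nu^\sigma)'(t)=\frac{-1}{\log q}\,\frac1t,\qquad t\in[q,1], \] that is, for every continuous function $g$ on $[0,1]$, \[ \lim_{n\to\infty}\frac1n\sum_{j=1}^n g\bigl(x_{j,n}^{1/n}\bigr)=\frac{-1}{\log q}\int_q^1 g(t)\,\frac{dt}{t}. \]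
   Context: Only the values $w(q^k)$ of $w$ on the lattice enter the orthogonality relation. The statement that the asymptotic distribution of the points $x_{1,n}^{1/n},\ldots,x_{n,n}^{1/n}$ is given by a probability measure $\nu$ on $[0,1]$ means weak convergence of the measures $\nu_n=\frac1n\sum_{j=1}^n\delta_{x_{j,n}^{1/n}}$ to $\nu$, i.e. $\int g\,d\nu_n\to\int g\,d\nu$ for every continuous $g$ on $[0,1]$. *)

(* Defs.v *)
From HB Require Import structures.
From mathcomp Require Export all_boot all_order all_algebra.
From mathcomp Require Export all_classical all_reals all_analysis.
From mathcomp Require Export measurable_realfun.

Set Implicit Arguments.
Unset Strict Implicit.
Unset Printing Implicit Defensive.

Import Order.TTheory GRing.Theory Num.Theory.
Import numFieldNormedType.Exports.

Local Open Scope classical_set_scope.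
Local Open Scope ring_scope.

Definition orthonormal_on_lattice (R : realType) (q : R) (w : R -> R)
    (p : nat -> {poly R}) : Prop :=
  forall n m : nat,
    series (fun k : nat =>
      (p n).[q ^+ k] * (p m).[q ^+ k] * (q ^+ k * w (q ^+ k))) @ \oo
    --> ((n == m)%:R : R).

(* [x 0 < ... < x (n - 1)] are exactly the zeros of [P]; the values [x j] with
   [n <= j] are irrelevant. *)
Definition increasing_zeros (R : realType) (P : {poly R}) (n : nat)
    (x : nat -> R) : Prop :=
  (forall i j : nat, (i < j < n)%N -> x i < x j) /\
  (forall t : R, root P t <-> exists2 j : nat, (j < n)%N & x j = t).

(* The measure (1/n) \sum_(j < n) \d_(x j), which is 0 for n = 0. *)
Definition empirical_measure (R : realType) (n : nat) (x : nat -> R) :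
    {measure set R -> \bar R} :=
  mscale (n%:R^-1)%:nng (msum (fun j : nat => \d_(x j)) n).

Definition weak_cvg01 (R : realType) (nu_ : nat -> {measure set R -> \bar R})
    (nu : {measure set R -> \bar R}) : Prop :=
  forall g : R -> R, {within `[0, 1], continuous g} ->
    \int[nu_ n]_(t in `[0, 1]) g t @[n --> \oo] --> \int[nu]_(t in `[0, 1]) g t.

Section nu_sigma.
Context (R : realType) (q : R).

(* Nonnegative without assuming 0 < q < 1, because [ln q = 0] for [q <= 0]. *)
Definition nu_sigma_density (t : R) : R :=
  if q <= t <= 1 then -1 / ln q * (1 / t) else 0.

Lemma nu_sigma_density_ge0 t : 0 <= nu_sigma_density t.
Proof.
rewrite /nu_sigma_density; case: ifPn => // /andP[qt t1].
have [q0|q0] := leP q 0; first by rewrite ln0// invr0 mulr0 mul0r.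
have t0 : 0 < t by exact: lt_le_trans qt.
rewrite mulr_ge0//; last by rewrite divr_ge0// ltW.
by rewrite mulNr mul1r oppr_ge0 invr_le0 ln_le0// (le_trans qt).
Qed.

Lemma measurable_nu_sigma_density : measurable_fun setT nu_sigma_density.
Proof.
rewrite /nu_sigma_density; apply: measurable_fun_if => //=.
  by apply: measurable_and => //; exact: measurable_fun_ler.
apply: measurable_funM => //.
have -> : (fun t : R => 1 / t) = GRing.inv by apply/funext => t; exact: div1r.
apply: measurable_funTS; rewrite -(setUv [set 0 : R]).
apply/measurable_funU => //; first exact: measurableC.
split; first exact: measurable_fun_set1.
apply: open_continuous_measurable_fun => [|t /[!inE] /eqP t0].
  by rewrite openC; exact: closed_eq.
exact: inv_continuous.
Qed.

Definition nu_sigma (A : set R) : \bar R :=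
  (\int[lebesgue_measure]_(t in A) (nu_sigma_density t)%:E)%E.

Let nu_sigma0 : nu_sigma set0 = 0%E.
Proof. by rewrite /nu_sigma integral_set0. Qed.

Let nu_sigma_ge0 A : (0 <= nu_sigma A)%E.
Proof. by apply: integral_ge0 => t _; rewrite lee_fin nu_sigma_density_ge0. Qed.

Let nu_sigma_sigma_additive : semi_sigma_additive nu_sigma.
Proof.
apply: (@semi_sigma_additive_nng_induced _ _ R lebesgue_measure
  (EFin \o nu_sigma_density)) => [|t].
  by apply/measurable_EFinP; exact: measurable_nu_sigma_density.
by rewrite lee_fin nu_sigma_density_ge0.
Qed.

HB.instance Definition _ := isMeasure.Build _ _ _ nu_sigma
  nu_sigma0 nu_sigma_ge0 nu_sigma_sigma_additive.

End nu_sigma.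

(* Main.v *)
Require Import Defs.
From HB Require Import structures.
From mathcomp Require Import zify ring lra.
Import Order.TTheory GRing.Theory Num.Theory.
Import numFieldNormedType.Exports.

Local Open Scope classical_set_scope.
Local Open Scope ring_scope.

(** Write [C] for the binomial coefficient ['C(n, 2)]. The monic polynomial with
    zeros [1, q, ..., q^(n-1)] is at most [q^C] in absolute value on the lattice,
    so extremality of [p_n] bounds its leading coefficient from below by a
    constant times [q^(-C)]. Conversely the leading coefficient is the sum over
    [k <= n] of [p_n(q^k) / D_k], where [D_k] is the product of the differences
    [q^k - q^j] ([j <= n], [j <> k]); orthonormality and the hypothesis on [w]
    make [p_n(q^k)] subexponential in [n^2], and [|D_k|] is at least
    [(1-q)^n q^(C - 'C(n-k, 2))]. This gives the matching upper bound, and shows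
    that only the nodes with [n - k = o(n)] can carry the leading coefficient.

    Hence for such a node [q^k] the product of the [|q^k - x_j|] over the zeros
    is at least [q^(C + o(n^2))]. Write the zeros in decreasing order as
    [q^(s_0), q^(s_1), ...]. Two zeros never lie between consecutive lattice
    points, so [s_j >= j]; as the product is at most [q^(\sum_j min(k, s_j))] and
    [\sum_(j < n) j = C], the total excess [\sum_j (min(n, s_j) - j)] is [o(n^2)].
    So averages over the [x_j^(1/n) = q^(s_j/n)] behave like Riemann sums over
    the points [q^(j/n)]. *)

(** * Interpolation at the lattice points *)

(** Compares coefficients of degree [n] in Lagrange's interpolation formula, where the numerators
    [l k] of the basis polynomials are monic of degree [n]. *)
Lemma lagrange_lead_coef (F : fieldType) (n : nat) (x : nat -> F) (P : {poly F}) :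
  (forall i j, (i <= n)%N -> (j <= n)%N -> x i = x j -> i = j) ->
  (size P <= n.+1)%N ->
  P`_n = \sum_(k < n.+1) P.[x k] / \prod_(j < n.+1 | j != k) (x k - x j).
Proof.
move=> xinj sP.
pose l (k : 'I_n.+1) := \prod_(j < n.+1 | j != k) ('X - (x j)%:P).
pose D (k : 'I_n.+1) := \prod_(j < n.+1 | j != k) (x k - x j).
have D0 k : D k != 0.
  rewrite /D; apply/prodf_neq0 => j jk; rewrite subr_eq0; apply: contra jk => /eqP e.
  by apply/eqP/val_inj/esym/xinj; rewrite ?leq_ord.
pose s (k : 'I_n.+1) := [seq x (j : 'I_n.+1) | j <- [seq j <- enum 'I_n.+1 | j != k]].
have lE k : l k = \prod_(a <- s k) ('X - a%:P).
  by rewrite big_map big_filter big_enum_cond.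
have sizeE k : size (s k) = n.
  rewrite size_map -(rem_filter k (enum_uniq _)) size_rem ?mem_enum//.
  by rewrite size_enum_ord.
have sl k : size (l k) = n.+1 by rewrite lE size_prod_XsubC sizeE.
have ln k : (l k)`_n = 1.
  have /monicP : l k \is monic by rewrite lE monic_prod_XsubC.
  by rewrite /lead_coef sl.
have -> : P = \sum_(k < n.+1) (P.[x k] / D k) *: l k.
  apply/eqP; rewrite -subr_eq0; apply/eqP.
  apply: (@roots_geq_poly_eq0 _ _ [seq x (j : 'I_n.+1) | j <- enum 'I_n.+1]).
  - apply/allP => _ /mapP[i _ ->]; rewrite /root hornerD hornerN horner_sum.
    rewrite (bigD1 i)//= big1 ?addr0 => [|j ji].
      rewrite hornerZ horner_prod.
      under eq_bigr do rewrite hornerXsubC.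
      by rewrite -mulrA mulVf ?D0// mulr1 subrr.
    by rewrite hornerZ /l horner_prod (bigD1 i) 1?eq_sym//= hornerXsubC subrr mul0r mulr0.
  - rewrite map_inj_uniq ?enum_uniq// => i j e.
    by apply/val_inj/xinj; rewrite ?leq_ord.
  - rewrite size_map size_enum_ord (leq_trans (size_polyD _ _))// geq_max sP.
    rewrite size_polyN (leq_trans (size_sum _ _ _))//.
    by apply/bigmax_leqP => k _; rewrite (leq_trans (size_scale_leq _ _))// sl.
rewrite coef_sum; apply: eq_bigr => k _.
rewrite coefZ ln mulr1 horner_sum (bigD1 k)//= big1 ?addr0 => [|j jk].
  rewrite hornerZ horner_prod.
  under [\prod_(j < n.+1 | j != k) ('X - _).[_]]eq_bigr do rewrite hornerXsubC.
  by rewrite -(mulrA _ (_^-1)) mulVf ?D0// mulr1.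
by rewrite hornerZ /l horner_prod (bigD1 k) 1?eq_sym//= hornerXsubC subrr mul0r mulr0.
Qed.

(** Up to a constant factor, [q ^+ k - q ^+ j] has size [q ^+ minn k j]. The indices [j < k]
    contribute ['C(k, 2)] and the others [k * (n - k)], which falls short of ['C(n, 2)] by
    ['C(n - k, 2)]. *)
Lemma sum_minn_bin2 (n k : nat) : (k <= n)%N ->
  (\sum_(j < n.+1 | j != k :> nat) minn k j + 'C(n - k, 2) = 'C(n, 2))%N.
Proof.
move=> kn; rewrite -(subnK kn); elim: (n - k)%N => [|m IH].
  rewrite add0n subnn bin0n addn0 big_mkcond big_ord_recr/= eqxx addn0 -triangular_sum big_mkord.
  by apply: eq_bigr => -[i/= ik] _; rewrite neq_ltn ik/=; apply/minn_idPr/ltnW.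
rewrite big_mkcond big_ord_recr/= -big_mkcond/=.
have -> : (m.+1 + k)%N != k by lia.
rewrite !addSn !binS !bin1 !addnK in IH *.
rewrite -IH subSn ?leq_addl// addnK binS bin1 (minn_idPl _) ?leqW ?leq_addl//.
by set s := (\sum_(_ < _ | _) _)%N; lia.
Qed.

Section geometric_nodes.
Context (R : realType) (q : R).
Hypotheses (q0 : 0 < q) (q1 : q < 1).

Lemma expr_inj01 (i j : nat) : q ^+ i = q ^+ j -> i = j.
Proof.
move=> e; apply/eqP; rewrite eqn_leq.
by rewrite -(ler_iXn2l q0 q1) e lexx -(ler_iXn2l q0 q1) e lexx.
Qed.

Lemma dist_expr_ge (i j : nat) : i != j ->
  (1 - q) * q ^+ minn i j <= `|q ^+ i - q ^+ j|.
Proof.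
wlog ij : i j / (i < j)%N.
  move=> H ij; have /orP[lij|lji] : (i < j)%N || (j < i)%N by rewrite -neq_ltn.
    exact: H.
  by rewrite minnC distrC H// eq_sym.
move=> _; rewrite (minn_idPl (ltnW ij)).
have -> : q ^+ i - q ^+ j = (1 - q ^+ (j - i).-1.+1) * q ^+ i.
  by rewrite prednK ?subn_gt0// mulrBl mul1r -exprD subnK// ltnW.
rewrite normrM ger0_norm ?subr_ge0 ?exprn_ile1 ?(ltW q0) ?(ltW q1)//.
rewrite (ger0_norm (exprn_ge0 _ (ltW q0))).
rewrite ler_wpM2r ?exprn_ge0 ?(ltW q0)// lerD2l lerN2 exprS.
by rewrite ler_piMr ?exprn_ile1 ?(ltW q0) ?(ltW q1).
Qed.

(** The power [q ^+ 'C(n - k, 2)] stays on the right so that no exponent involves a difference of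
    binomials. *)
Lemma node_product_ge (n : nat) (k : 'I_n.+1) :
  (1 - q) ^+ n * q ^+ 'C(n, 2) <=
  `|\prod_(j < n.+1 | j != k) (q ^+ k - q ^+ j)| * q ^+ 'C(n - k, 2).
Proof.
rewrite -(@sum_minn_bin2 n k) ?leq_ord// exprD mulrA.
rewrite ler_wpM2r ?exprn_ge0 ?(ltW q0)// normr_prod.
have -> : (1 - q) ^+ n = \prod_(j < n.+1 | j != k) (1 - q).
  rewrite prodr_const; congr (_ ^+ _); rewrite cardC1 card_ord.
  by [].
rewrite (big_morph _ (exprD q) (expr0 q)).
under [X in _ * X]eq_bigl do rewrite val_eqE.
rewrite -big_split/=.
apply: ler_prod => j jk; rewrite mulr_ge0 ?exprn_ge0 ?subr_ge0 ?(ltW q0) ?(ltW q1)//=.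
by rewrite dist_expr_ge// eq_sym.
Qed.

End geometric_nodes.

Lemma near_linear_le_quadratic (R : realType) (A B c : R) : 0 < c ->
  \forall n \near \oo, A * n%:R + B <= c * n%:R ^+ 2.
Proof.
move=> c0; near=> n.
have n1 : 1 <= n%:R :> R by near: n; exact: nbhs_infty_ger.
have : (`|A| + `|B|) / c <= n%:R by near: n; exact: nbhs_infty_ger.
rewrite ler_pdivrMr// => h.
have := ler_norm A; have := ler_norm B; have := normr_ge0 B; nra.
Unshelve. all: by end_near. Qed.

Lemma bin2_real (R : realType) (n : nat) :
  'C(n, 2)%:R = (n%:R ^+ 2 - n%:R) / 2 :> R.
Proof.
elim: n => [|n IH]; first by rewrite bin0n expr0n/= subrr mul0r.
by rewrite binS bin1 natrD IH -natr1; field.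
Qed.

(** * Orthonormal polynomials on the lattice *)

Section lattice_polynomials.
Context (R : realType) (q : R) (w : R -> R) (p : nat -> {poly R}).
Context (x : nat -> nat -> R).
Hypotheses (q0 : 0 < q) (q1 : q < 1).
Hypothesis (w_gt0 : forall t : R, 0 < t -> t <= 1 -> 0 < w t).
Hypothesis (w_sum : cvgn (series (fun k : nat => q ^+ k * w (q ^+ k)))).
Hypothesis (size_p : forall n : nat, size (p n) = n.+1).
Hypothesis (lead_gt0 : forall n : nat, 0 < lead_coef (p n)).
Hypothesis (p_ortho : orthonormal_on_lattice q w p).
Hypothesis (x_zeros : forall n : nat, increasing_zeros (p n) n (x n)).
Hypothesis (w_lim : forall a b : R, 0 < a -> a < b -> b <= 1 ->
      {uniform `[a, b],
        (fun (n : nat) (t : R) => 1 / n%:R ^+ 2 * ln (w (t ^+ n))) @ \oo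
        --> (fun _ : R => 0 : R)}).

Let om k := q ^+ k * w (q ^+ k).
(** The inner product is kept as the sequence of its partial sums: a statement on its limit then
    carries both the convergence and the value. *)
Let ip (P Q : {poly R}) : R ^nat :=
  series (fun k : nat => P.[q ^+ k] * Q.[q ^+ k] * om k).

Lemma exprn_itv01 k : (0 < q ^+ k) * (q ^+ k <= 1).
Proof. by rewrite exprn_gt0// exprn_ile1// ltW. Qed.

Lemma mass_gt0 k : 0 < om k.
Proof. by rewrite mulr_gt0 ?w_gt0 ?exprn_itv01. Qed.

Lemma ip_ortho n m : ip (p n) (p m) @ \oo --> ((n == m)%:R : R).
Proof. exact: p_ortho. Qed.

Lemma ipDZr (P Q S : {poly R}) (c a b : R) :
  ip P Q @ \oo --> a -> ip P S @ \oo --> b ->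
  ip P (c *: Q + S) @ \oo --> c * a + b.
Proof.
move=> ha hb; have -> : ip P (c *: Q + S) = fun n => c * ip P Q n + ip P S n.
  apply/funext => n; rewrite /ip /series/= mulr_sumr -big_split/=.
  by apply: eq_bigr => k _; rewrite hornerD hornerZ; ring.
by apply: cvgD => //; apply: cvgM => //; exact: cvg_cst.
Qed.

Lemma ortho_lower n (r : {poly R}) : (size r <= n)%N ->
  ip (p n) r @ \oo --> (0 : R).
Proof.
have H m : (m <= n)%N -> forall r : {poly R}, (size r <= m)%N ->
    ip (p n) r @ \oo --> (0 : R).
  elim: m => [_ {}r|m IH mn {}r sr].
    rewrite leqn0 size_poly_eq0 => /eqP ->.
    rewrite /ip (_ : (fun _ => _) = fun=> 0) /series/=; last first.
      by apply/funext => k; rewrite horner0; ring.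
    under eq_fun do rewrite big1//.
    exact: cvg_cst.
  pose c := r`_m / lead_coef (p m).
  rewrite (_ : r = c *: p m + (r - c *: p m)); last by rewrite addrC subrK.
  rewrite -(addr0 0) -{1}(mulr0 c); apply: ipDZr.
    by have := @ip_ortho n m; rewrite gtn_eqF.
  apply: IH; first exact: ltnW.
  apply/leq_sizeP => j; rewrite leq_eqVlt => /predU1P[<-|mj].
    rewrite coefB coefZ /c lead_coefE size_p/= divfK ?subrr//.
    by have := lead_gt0 m; rewrite lead_coefE size_p => /gt_eqF ->.
  by rewrite coefB coefZ !(leq_sizeP _ _ _ _ mj) ?size_p ?mulr0 ?subr0.
exact: H.
Qed.

Lemma sqr_mass_le1 n k : (p n).[q ^+ k] ^+ 2 * om k <= 1.
Proof.
have h : ip (p n) (p n) @ \oo --> (1 : R) by have := @ip_ortho n n; rewrite eqxx.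
have t0 i : 0 <= (p n).[q ^+ i] * (p n).[q ^+ i] * om i.
  by rewrite mulr_ge0 ?(ltW (mass_gt0 _))// -expr2 sqr_ge0.
rewrite -(cvg_lim (@Rhausdorff R) h).
apply: (@le_trans _ _ (ip (p n) (p n) k.+1)).
  by rewrite /ip /series/= big_nat_recr//= -expr2 lerDr sumr_ge0.
apply: nondecreasing_cvgn_le; last by apply/cvg_ex; exists 1.
by apply: nondecreasing_series => i _ _; exact: t0.
Qed.

(** Let [Q] be monic with the first [n] lattice points as zeros. Then [g *: Q] has inner product 1
    with [p n], while its squared norm is at most [(g * q ^+ 'C(n, 2)) ^+ 2] times the total
    mass. *)
Lemma lead_coef_ge : exists2 S : R, 1 <= S &
  forall n, 1 <= S * lead_coef (p n) * q ^+ 'C(n, 2).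
Proof.
(* The maximum with 1 gives [S <= S ^+ 2], which avoids a square root of the total mass at the
   end. *)
pose S0 := limn (series om); pose S := Num.max 1 S0.
have S1 : 1 <= S by rewrite le_max lexx.
exists S => // n; set g := lead_coef (p n).
have g0 : 0 < g by exact: lead_gt0.
pose Q := \prod_(j <- iota 0 n) ('X - (q ^+ j)%:P).
have Qn : size Q = n.+1 by rewrite size_prod_XsubC size_iota.
have Ql : Q`_n = 1.
  have /monicP : Q \is monic by rewrite monic_prod_XsubC.
  by rewrite /lead_coef Qn.
have Qk k : `|Q.[q ^+ k]| <= q ^+ 'C(n, 2).
  rewrite horner_prod normr_prod -triangular_sum.
  rewrite (big_morph _ (exprD q) (expr0 q)) /index_iota subn0 !big_seq.
  (* For [k < n] one factor vanishes; for [k >= n] each factor is at most [q ^+ i] in absolute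
     value. *)
  have [kn|nk] := ltnP k n.
    rewrite -big_seq (bigD1_seq k) ?mem_iota ?iota_uniq//= hornerXsubC subrr normr0 mul0r.
    by rewrite -big_seq prodr_ge0// => i _; rewrite exprn_ge0// ltW.
  apply: ler_prod => i; rewrite mem_iota add0n => /andP[_ ilt].
  rewrite normr_ge0 hornerXsubC/= ler0_norm ?opprB.
    by rewrite lerBlDr lerDl exprn_ge0// ltW.
  by rewrite subr_le0 ler_wiXn2l ?(ltW q0) ?(ltW q1)// (leq_trans (ltnW ilt)).
have pQ : ip (p n) (g *: Q) @ \oo --> (1 : R).
  rewrite (_ : g *: Q = 1 *: p n + (g *: Q - p n)); last by rewrite scale1r addrC subrK.
  rewrite -[X in _ --> X]addr0 -[X in _ --> X + _]mul1r; apply: ipDZr.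
    by have := @ip_ortho n n; rewrite eqxx.
  apply: ortho_lower; apply/leq_sizeP => j; rewrite leq_eqVlt => /predU1P[<-|nj].
    by rewrite coefB coefZ Ql mulr1 /g lead_coefE size_p subrr.
  by rewrite coefB coefZ !(leq_sizeP _ _ _ _ nj) ?size_p ?Qn ?mulr0 ?subr0.
pose B := (g * q ^+ 'C(n, 2)) ^+ 2 * S.
have h2 : 2 <= 1 + B.
  (* [2 a b <= a^2 + b^2] summed against the masses, with [a = p_n] and
     [b = g Q], replaces the minimality of the norm of [p_n]. *)
  have hl : 2 * ip (p n) (g *: Q) N @[N --> \oo] --> 2 * (1 : R).
    by apply: cvgM => //; exact: cvg_cst.
  have hr : ip (p n) (p n) N + B @[N --> \oo] --> (1 + B : R).
    by apply: cvgD; [have := @ip_ortho n n; rewrite eqxx|exact: cvg_cst].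
  rewrite -(mulr1 2); apply: (ler_cvg_to hl hr).
  apply: nearW => N /=.
  have om0 : nondecreasing_seq (series om).
    by apply: nondecreasing_series => i _ _; exact/ltW/mass_gt0.
  apply: (@le_trans _ _ (ip (p n) (p n) N + (g * q ^+ 'C(n, 2)) ^+ 2 * series om N)).
    rewrite /ip /series/= !mulr_sumr -big_split/=.
    apply: ler_sum => k _; rewrite mulrA [_ ^+ 2 * om k]mulrC [om k * _]mulrC -mulrDl.
    rewrite ler_wpM2r ?(ltW (mass_gt0 _))// hornerZ.
    set a := (p n).[_]; set b := Q.[_]; set c := q ^+ 'C(n, 2).
    have bc : b ^+ 2 <= c ^+ 2.
      by rewrite -[b ^+ 2]real_normK ?num_real// lerXn2r ?nnegrE ?exprn_ge0 ?(ltW q0) ?Qk.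
    have : 0 <= (a - g * b) ^+ 2 by exact: sqr_ge0.
    have : g ^+ 2 * b ^+ 2 <= g ^+ 2 * c ^+ 2 by rewrite ler_wpM2l ?sqr_ge0.
    by rewrite exprMn; nra.
  rewrite lerD2l /B ler_wpM2l ?sqr_ge0// le_max; apply/orP; right.
  exact: nondecreasing_cvgn_le.
have B1 : 1 <= B by lra.
have S0' : 0 <= S by lra.
rewrite -mulrA -(@ler_pXn2r _ 2)// ?nnegrE ?mulr_ge0 ?exprn_ge0 ?(ltW q0) ?(ltW g0)//.
rewrite expr1n exprMn (le_trans B1)// /B mulrC ler_wpM2r ?sqr_ge0// expr2.
by rewrite ler_peMl.
Qed.

(** * Location of the zeros *)

(** The product [p n * r = A * r ^+ 2] is nonnegative on the lattice and its weighted sum is 0 by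
    orthogonality, so it vanishes at infinitely many points although it is a nonzero polynomial. *)
Lemma no_sign_factor n (A r : {poly R}) : p n = A * r -> (size r <= n)%N ->
  (forall k, 0 <= A.[q ^+ k]) -> False.
Proof.
move=> pE sr A0.
have h := @ortho_lower n r sr.
have t0 i : 0 <= (p n).[q ^+ i] * r.[q ^+ i] * om i.
  rewrite pE hornerM -(mulrA A.[_]) -expr2 mulr_ge0 ?(ltW (mass_gt0 _))//.
  by rewrite mulr_ge0 ?sqr_ge0.
have z k : root (p n * r) (q ^+ k).
  have : ip (p n) r k.+1 <= 0.
    rewrite -(cvg_lim (@Rhausdorff R) h).
    apply: nondecreasing_cvgn_le; last by apply/cvg_ex; exists 0.
    by apply: nondecreasing_series => i _ _; exact: t0.
  rewrite /ip /series/= big_nat_recr//= => le0.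
  have : (p n).[q ^+ k] * r.[q ^+ k] * om k <= 0.
    by rewrite (le_trans _ le0)// lerDr sumr_ge0.
  move=> le0'; have /eqP : (p n).[q ^+ k] * r.[q ^+ k] * om k = 0.
    by apply/eqP; rewrite eq_le le0' t0.
  by rewrite mulf_eq0 (gt_eqF (mass_gt0 k)) orbF /root hornerM.
have p0 : p n != 0 by rewrite -size_poly_eq0 size_p.
have r0 : r != 0 by apply: contra p0 => /eqP r0; rewrite pE r0 mulr0.
suff /eqP : p n * r = 0 by rewrite mulf_eq0 (negbTE p0) (negbTE r0).
apply: (@roots_geq_poly_eq0 _ _ [seq q ^+ k | k <- iota 0 (size (p n * r))]).
- by apply/allP => _ /mapP[k _ ->]; exact: z.
- by rewrite map_inj_uniq ?iota_uniq// => i j; exact: expr_inj01.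
- by rewrite size_map size_iota.
Qed.

Lemma root_zero n i : (i < n)%N -> root (p n) (x n i).
Proof. by move=> ltin; apply/(x_zeros n).2; exists i. Qed.

Lemma prod_zerosE n :
  p n = lead_coef (p n) *: \prod_(i < n) ('X - (x n i)%:P).
Proof.
have := @all_roots_prod_XsubC _ (p n) [seq x n i | i <- iota 0 n].
have -> : iota 0 n = index_iota 0 n by rewrite /index_iota subn0.
rewrite big_map big_mkord; apply.
- by rewrite size_p size_map size_iota subn0.
- by apply/allP => _ /mapP[i + ->]; rewrite mem_index_iota => /andP[_ ?]; exact: root_zero.
- rewrite uniq_rootsE map_inj_in_uniq ?iota_uniq// => i j.
  rewrite !mem_index_iota => /andP[_ ltin] /andP[_ jn] e.
  have [ij|ji|//] := ltngtP i j.
    by have := (x_zeros n).1 i j; rewrite ij jn e ltxx => /(_ erefl).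
  by have := (x_zeros n).1 j i; rewrite ji ltin e ltxx => /(_ erefl).
Qed.

Lemma p_root_factor n a : root (p n) a ->
  exists2 r : {poly R}, p n = r * ('X - a%:P) & size r = n.
Proof.
move=> /factor_theorem[r pE]; exists r => //.
have r0 : r != 0.
  by apply/eqP => r0; have := size_p n; rewrite pE r0 mul0r size_poly0.
by have := size_p n; rewrite pE size_Mmonic ?monicXsubC// size_XsubC addn2/= => -[].
Qed.

Lemma zero_gt0 n i : (i < n)%N -> 0 < x n i.
Proof.
move=> /root_zero/p_root_factor[r pE sr]; rewrite ltNge; apply/negP => x0.
apply: (@no_sign_factor n ('X - (x n i)%:P) r); rewrite ?sr 1?mulrC// => k.
by rewrite hornerXsubC subr_ge0 (le_trans x0)// exprn_ge0// ltW.
Qed.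

Lemma zero_lt1 n i : (i < n)%N -> x n i < 1.
Proof.
move=> /root_zero/p_root_factor[r pE sr]; rewrite ltNge; apply/negP => x1.
apply: (@no_sign_factor n (- ('X - (x n i)%:P)) (- r)); rewrite ?size_polyN ?sr// ?mulrNN 1?mulrC// => k.
by rewrite hornerN hornerXsubC opprB subr_ge0 (le_trans _ x1)// exprn_ile1// ltW.
Qed.

(** No lattice point lies strictly between [a] and [b], so [('X - a%:P) * ('X - b%:P)] is a factor
    that is nonnegative on the lattice. *)
Lemma one_zero_per_cell n j a b : root (p n) a -> root (p n) b ->
  q ^+ j.+1 <= a -> a < b -> b <= q ^+ j -> False.
Proof.
move=> ra rb ja ab bj.
have [r pE sr] := p_root_factor n a ra.
have /factor_theorem[s rE] : root r b.
  move: rb; rewrite pE rootM root_XsubC => /orP[//|/eqP e].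
  by rewrite e ltxx in ab.
have ss : (size s <= n)%N.
  have r0 : r != 0.
    by apply/eqP => r0; have := size_p n; rewrite pE r0 mul0r size_poly0.
  have s0 : s != 0 by apply: contra r0 => /eqP s0; rewrite rE s0 mul0r.
  by rewrite -sr rE size_Mmonic ?monicXsubC// size_XsubC addn2 leqnSn.
apply: (@no_sign_factor n (('X - a%:P) * ('X - b%:P)) s) => //.
  by rewrite pE rE; ring.
move=> k; rewrite hornerM !hornerXsubC.
have [kj|jk] := leqP k j.
  have h : q ^+ j <= q ^+ k by rewrite ler_wiXn2l// ltW.
  by rewrite mulr_ge0// subr_ge0 ?(le_trans bj)// (le_trans (ltW ab))// (le_trans bj).
have h : q ^+ k <= q ^+ j.+1 by rewrite ler_wiXn2l// ltW.
by rewrite mulr_le0// subr_le0 ?(le_trans h)// (le_trans ja)// ltW.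
Qed.

(** The zero [x n (n.-1 - j)] has rank [j] from the top. If the next one exceeded [q ^+ j.+1], both
    would lie in the cell from [q ^+ j.+1] to [q ^+ j]. *)
Lemma zero_le_lattice n j : (j < n)%N -> x n (n.-1 - j) <= q ^+ j.
Proof.
elim: j => [n0|j IH jn]; first by rewrite expr0 ltW// zero_lt1// subn0 prednK.
rewrite leNgt; apply/negP => h.
have lt_x : x n (n.-1 - j.+1) < x n (n.-1 - j) by apply: (x_zeros n).1; lia.
apply: (@one_zero_per_cell n j _ _ _ _ (ltW h) lt_x (IH (ltnW jn)));
  apply: root_zero; lia.
Qed.

(** * Growth of the leading coefficient *)

Let L := - ln q.
Let c0 := - ln (1 - q).

Lemma Nln_gt0 : 0 < L.
Proof. by rewrite oppr_gt0 ln_lt0// q0. Qed.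

Lemma expr_expR n : q ^+ n = expR (- (L * n%:R)).
Proof. by rewrite mulNr opprK expRM_natr lnK. Qed.

(** For [k <= n] the point [q ^+ k] is the [n]-th power of [q^(k/n)], which lies in [[q, 1]];
    uniformity on this single interval handles all such [k] at once. *)
Lemma weight_subexponential (e : R) : 0 < e -> \forall n \near \oo,
  forall k, (k <= n)%N -> expR (- (e * n%:R ^+ 2)) <= w (q ^+ k).
Proof.
move=> e0.
have := w_lim q 1 q0 q1 (lexx _).
move=> /(_ [set h : R -> R | forall t, `[q, 1]%classic t -> ball (0 : R) e (h t)]).
rewrite nbhs_filterE => h; have {h} : nbhs \oo [set n | forall t, `[q, 1]%classic t ->
    ball (0 : R) e (1 / n%:R ^+ 2 * ln (w (t ^+ n)))].
  apply: h; apply/uniform_nbhs.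
  by exists [set xy | ball xy.1 e xy.2]; split => //; rewrite -entourage_ballE; exists e.
move=> h; near=> n => k kn.
have n0 : (0 < n)%N by near: n; exact: nbhs_infty_gt.
have nR0 : 0 < n%:R :> R by rewrite ltr0n.
pose t := expR (- (L * (k%:R / n%:R))).
have tn : t ^+ n = q ^+ k.
  by rewrite /t -expRM_natr expr_expR; congr expR; field; rewrite gt_eqF.
have kn1 : k%:R / n%:R <= 1 :> R by rewrite ler_pdivrMr// mul1r ler_nat.
have kn0 : 0 <= k%:R / n%:R :> R by rewrite divr_ge0.
have tq : `[q, 1]%classic t.
  rewrite /= in_itv/= -[X in X <= t]lnK ?posrE// -[X in t <= X]expR0 !ler_expR.
  have L0 := Nln_gt0; have -> : ln q = - L by rewrite /L opprK.
  by rewrite oppr_le0 mulr_ge0 ?(ltW L0)// andbT lerN2 ler_piMr// ltW.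
have hn : forall t, `[q, 1]%classic t -> ball (0 : R) e (1 / n%:R ^+ 2 * ln (w (t ^+ n))).
  by near: n.
have := hn t tq; rewrite tn /ball/= sub0r normrN => /ltW.
rewrite ler_norml => /andP[+ _]; rewrite div1r mulrC ler_pdivlMr ?exprn_gt0// => le.
rewrite -[w _]lnK ?ler_expR ?posrE -?mulNr//.
by rewrite w_gt0 ?exprn_gt0// exprn_ile1// ltW.
Unshelve. all: by end_near. Qed.

Lemma node_value_le (e : R) : 0 < e -> \forall n \near \oo,
  forall k, (k <= n)%N -> `|(p n).[q ^+ k]| <= expR (L * n%:R + e * n%:R ^+ 2).
Proof.
move=> e0; near=> n => k kn.
have we : forall k, (k <= n)%N -> expR (- (e * n%:R ^+ 2)) <= w (q ^+ k).
  by near: n; exact: weight_subexponential.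
set B := expR _.
(* Because [B >= 1], the bound [a ^+ 2 <= B] obtained below already yields [|a| <= B]. *)
have B1 : 1 <= B.
  by rewrite -expR0 ler_expR addr_ge0// mulr_ge0 ?sqr_ge0 ?(ltW Nln_gt0) ?(ltW e0).
have hB : B^-1 <= q ^+ k * w (q ^+ k).
  rewrite -expRN opprD expRD ler_pM ?expR_ge0 ?we//.
  by rewrite -expr_expR ler_wiXn2l// ltW.
have := sqr_mass_le1 n k.
set a := (p n).[_] => h.
have : a ^+ 2 <= B.
  rewrite -[B]invrK -div1r ler_pdivlMr ?invr_gt0 ?expR_gt0//.
  by rewrite (le_trans _ h)// ler_wpM2l ?sqr_ge0.
rewrite -real_normK ?num_real// => ha.
by have := normr_ge0 a; nra.
Unshelve. all: by end_near. Qed.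

Let D n (k : 'I_n.+1) : R := \prod_(j < n.+1 | j != k) (q ^+ k - q ^+ j).

Lemma norm_nodeD_ge n (k : 'I_n.+1) :
  expR (- (c0 * n%:R) - L * 'C(n, 2)%:R + L * 'C(n - k, 2)%:R) <= `|D n k|.
Proof.
have := @node_product_ge R q q0 q1 n k; rewrite -/(D n k).
have -> : (1 - q) ^+ n = expR (- (c0 * n%:R)).
  by rewrite mulNr opprK expRM_natr lnK// posrE subr_gt0.
rewrite !expr_expR -expRD => h.
rewrite expRD -[X in _ * expR X]opprK [expR (- - _)]expRN.
by rewrite ler_pdivrMr ?expR_gt0.
Qed.

(** The term in ['C(n - k, 2)] is a gain that [ln_lead_coef_le] discards, but with which
    [large_node] rules out nodes with [n - k] large. *)
Lemma lagrange_term_le (e : R) : 0 < e -> \forall n \near \oo,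
  forall k : 'I_n.+1, `|(p n).[q ^+ k] / D n k| <=
    expR ((L + c0) * n%:R + e * n%:R ^+ 2 + L * 'C(n, 2)%:R - L * 'C(n - k, 2)%:R).
Proof.
move=> e0; near=> n => k.
have hv : forall k, (k <= n)%N -> `|(p n).[q ^+ k]| <= expR (L * n%:R + e * n%:R ^+ 2).
  by near: n; exact: node_value_le.
have D0 : 0 < `|D n k| by rewrite (lt_le_trans _ (norm_nodeD_ge n k))// expR_gt0.
rewrite normrM normfV ler_pdivrMr//.
apply: (le_trans (hv k (leq_ord k))).
apply: (le_trans _ (ler_wpM2l (expR_ge0 _) (norm_nodeD_ge n k))).
by rewrite -expRD ler_expR; lra.
Unshelve. all: by end_near. Qed.

Lemma lead_coef_sum n : lead_coef (p n) = \sum_(k < n.+1) (p n).[q ^+ k] / D n k.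
Proof.
rewrite lead_coefE size_p/= (@lagrange_lead_coef _ n (fun k => q ^+ k)) ?size_p//.
by move=> i j _ _; exact: expr_inj01.
Qed.

Lemma ln_lead_coef_le (e : R) : 0 < e -> \forall n \near \oo,
  ln (lead_coef (p n)) <= (L + c0 + 1) * n%:R + e * n%:R ^+ 2 + L * 'C(n, 2)%:R.
Proof.
move=> e0; near=> n.
have ht : forall k : 'I_n.+1, `|(p n).[q ^+ k] / D n k| <=
    expR ((L + c0) * n%:R + e * n%:R ^+ 2 + L * 'C(n, 2)%:R - L * 'C(n - k, 2)%:R).
  by near: n; exact: lagrange_term_le.
rewrite -ler_expR lnK ?posrE ?lead_gt0// lead_coef_sum.
apply: (le_trans (ler_norm _)); apply: (le_trans (ler_norm_sum _ _ _)).
apply: (@le_trans _ _ (\sum_(k < n.+1) expR ((L + c0) * n%:R + e * n%:R ^+ 2 + L * 'C(n, 2)%:R))).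
  apply: ler_sum => k _; apply: (le_trans (ht k)).
  by rewrite ler_expR lerBlDr lerDl mulr_ge0// ltW// Nln_gt0.
rewrite sumr_const card_ord -[_ *+ n.+1]mulr_natl.
(* The number [n.+1] of terms is absorbed by [expR n%:R], whence the [+ 1] in the linear
   coefficient. *)
have : n.+1%:R <= expR n%:R :> R by rewrite -natr1 addrC expR_ge1Dx.
move=> /(ler_wpM2r (expR_ge0 ((L + c0) * n%:R + e * n%:R ^+ 2 + L * 'C(n, 2)%:R))).
by move=> /le_trans; apply; rewrite -expRD ler_expR; lra.
Unshelve. all: by end_near. Qed.

Lemma ln_lead_coef_ge : exists2 C : R, 0 <= C &
  forall n, L * 'C(n, 2)%:R - C <= ln (lead_coef (p n)).
Proof.
have [S S1 hS] := lead_coef_ge.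
have S0 : 0 < S by rewrite (lt_le_trans ltr01).
exists (ln S) => [|n]; first exact: ln_ge0.
have := hS n; rewrite expr_expR -{1}expR0 -{1}[S]lnK ?posrE//.
rewrite -{1}[lead_coef _]lnK ?posrE ?lead_gt0// -!expRD ler_expR; lra.
Qed.

Lemma cvg_lead_coef :
  lead_coef (p n) `^ (1 / n%:R ^+ 2) @[n --> \oo] --> q `^ (- (1 / 2)).
Proof.
rewrite {2}/powR gt_eqF//.
have -> : (fun n => lead_coef (p n) `^ (1 / n%:R ^+ 2)) =
          expR \o (fun n => 1 / n%:R ^+ 2 * ln (lead_coef (p n))).
  by apply/funext => n /=; rewrite /powR gt_eqF// lead_gt0.
apply: (@cvg_comp _ _ _ _ expR); last exact: continuous_expR.
apply/cvgrPdist_le => e e0.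
have e2 : 0 < e / 2 by lra.
have [C C0 hC] := ln_lead_coef_ge.
near=> n.
have n1 : 1 <= n%:R :> R by near: n; exact: nbhs_infty_ger.
have hu : ln (lead_coef (p n)) <= (L + c0 + 1) * n%:R + e / 2 * n%:R ^+ 2 + L * 'C(n, 2)%:R.
  by near: n; exact: ln_lead_coef_le.
have hl := hC n.
have h1 : (L + c0 + 1) * n%:R + 0 <= e / 2 * n%:R ^+ 2.
  by near: n; exact: near_linear_le_quadratic.
have h2 : L * n%:R + C <= e / 2 * n%:R ^+ 2.
  by near: n; exact: near_linear_le_quadratic.
have n2 : 0 < n%:R ^+ 2 :> R by rewrite exprn_gt0// (lt_le_trans ltr01).
rewrite bin2_real in hu hl.
rewrite ler_norml; set l := ln (lead_coef _) in hu hl *.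
have -> : - (1 / 2) * ln q - 1 / n%:R ^+ 2 * l = (L / 2 * n%:R ^+ 2 - l) / n%:R ^+ 2.
  by rewrite /L; field; rewrite gt_eqF// (lt_le_trans ltr01).
rewrite ler_pdivlMr// ler_pdivrMr//.
have Ln : 0 <= L * n%:R by rewrite mulr_ge0 ?(ltW Nln_gt0).
have en : 0 <= e * n%:R ^+ 2 by rewrite mulr_ge0 ?(ltW e0) ?(ltW n2).
apply/andP; split; lra.
Unshelve. all: by end_near. Qed.

(** * Logarithmic excess of the zeros *)

(** By pigeonhole some interpolation term exceeds [g * E]. A node with [n - k > d * n] has too small
    a term for that, and at a near node the lower bound on the term becomes one on the product of
    distances to the zeros. *)
Lemma large_node (d : R) : 0 < d -> \forall n \near \oo,
  exists k : 'I_n.+1, n%:R - k%:R <= d * n%:R /\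
    expR (- ((c0 + 1) * n%:R + 1) - L * 'C(n, 2)%:R) <=
    \prod_(i < n) `|q ^+ k - x n i|.
Proof.
move=> d0; have L0 := Nln_gt0.
(* A node with [n - k > d * n] gains [L * (d * n) ^+ 2 / 2 = 4 * e * n ^+ 2] up to a linear term,
   against an error [e * n ^+ 2] from [lagrange_term_le] and at most as much again from the linear
   terms. *)
pose e := L * d ^+ 2 / 8.
have e0 : 0 < e by rewrite /e divr_gt0// mulr_gt0// exprn_gt0.
have [C C0 hC] := ln_lead_coef_ge.
near=> n.
have ht : forall k : 'I_n.+1, `|(p n).[q ^+ k] / D n k| <=
    expR ((L + c0) * n%:R + e * n%:R ^+ 2 + L * 'C(n, 2)%:R - L * 'C(n - k, 2)%:R).
  by near: n; exact: lagrange_term_le.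
have hn : (L + c0 + L + 1) * n%:R + (C + 1) <= e * n%:R ^+ 2.
  by near: n; exact: near_linear_le_quadratic.
apply: contrapT => H.
set g := lead_coef (p n).
have g0 : 0 < g by exact: lead_gt0.
pose E : R := expR (- (n%:R + 1)).
have Elt : n.+1%:R * E < 1.
  have : n.+1%:R < expR (n%:R + 1) :> R.
    by rewrite -natr1 (lt_trans _ (expR_gt1Dx _)) ?ltrDr//.
  by rewrite /E expRN ltr_pdivrMr ?expR_gt0// mul1r.
(* If every interpolation term were below [g E], their sum could not reach [g]. *)
suff small (k : 'I_n.+1) : `|(p n).[q ^+ k] / D n k| <= g * E.
  have : g <= n.+1%:R * (g * E).
    rewrite {1}/g lead_coef_sum (le_trans (ler_norm _))//.
    rewrite (le_trans (ler_norm_sum _ _ _))//.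
    apply: (@le_trans _ _ (\sum_(k < n.+1) g * E)); first exact: ler_sum.
    by rewrite sumr_const card_ord -[_ *+ n.+1]mulr_natl.
  by nra.
rewrite leNgt; apply/negP => big; apply: H; exists k; split.
  rewrite leNgt; apply/negP => far; move: big; apply/negP; rewrite -leNgt.
  apply: (le_trans (ht k)).
  rewrite -[g]lnK ?posrE// -expRD ler_expR.
  have := hC n; rewrite -/g.
  have kn := leq_ord k.
  have : (d * n%:R) ^+ 2 <= (n%:R - k%:R) ^+ 2.
    by rewrite ler_sqr ?nnegrE ?mulr_ge0 ?(ltW d0) ?subr_ge0 ?ler_nat// ltW.
  rewrite !bin2_real natrB// => h1 h2.
  have h3 : L * (d * n%:R) ^+ 2 <= L * (n%:R - k%:R) ^+ 2 by rewrite ler_wpM2l// ltW.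
  have h4 : L * (n%:R - k%:R) <= L * n%:R by rewrite ler_wpM2l ?(ltW L0)// lerBlDr lerDl.
  have eE : e * n%:R ^+ 2 = L * (d * n%:R) ^+ 2 / 8 by rewrite /e; field.
  have h5 : 0 <= L * (d * n%:R) ^+ 2 by rewrite mulr_ge0 ?sqr_ge0 ?(ltW L0).
  have h6 : 0 <= L * n%:R by rewrite mulr_ge0 ?(ltW L0).
  move: hn; rewrite eE; lra.
have D0 : 0 < `|D n k| by rewrite (lt_le_trans _ (norm_nodeD_ge n k))// expR_gt0.
(* Since [p n] is [g] times the product over its zeros, [g] cancels, and the lower bound on [D n k]
   supplies the power of [q]. *)
move: big; rewrite normrM normfV ltr_pdivlMr// {1}(prod_zerosE n).
rewrite hornerZ normrM -/g gtr0_norm// -mulrA ltr_pM2l//.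
have -> : `|(\prod_(i < n) ('X - (x n i)%:P)).[q ^+ k]| = \prod_(i < n) `|q ^+ k - x n i|.
  by rewrite horner_prod normr_prod; apply: eq_bigr => i _; rewrite hornerXsubC.
move=> /ltW; apply: le_trans.
apply: (le_trans _ (ler_wpM2l (expR_ge0 _) (norm_nodeD_ge n k))).
rewrite -expRD ler_expR.
have : 0 <= L * 'C(n - k, 2)%:R by rewrite mulr_ge0// ltW.
by lra.
Unshelve. all: by end_near. Qed.

(** Exponent of a zero as a power of [q]; the reversed index lists the zeros in decreasing order. *)
Let s n i : R := - ln (x n (n.-1 - i)) / L.

Lemma zero_expR n i : (i < n)%N -> x n (n.-1 - i) = expR (- (L * s n i)).
Proof.
move=> ltin; rewrite /s mulrC divfK ?gt_eqF ?Nln_gt0// opprK lnK// posrE.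
by apply: zero_gt0; lia.
Qed.

Lemma log_zero_ge n i : (i < n)%N -> i%:R <= s n i.
Proof.
move=> ltin.
have := zero_le_lattice n i ltin.
by rewrite zero_expR// expr_expR ler_expR lerN2 ler_pM2l// Nln_gt0.
Qed.

Lemma sum_nat_bin2 n : \sum_(i < n) i%:R = 'C(n, 2)%:R :> R.
Proof. by rewrite -triangular_sum big_mkord natr_sum. Qed.

(** A factor [|q ^+ k - q^s|] is at most [q^(min(k, s))], so the node of [large_node] bounds the sum
    of these minima. The truncation reflects that a zero far below [q ^+ k] gives a factor close to
    [q ^+ k] whatever its exponent. *)
Lemma truncated_excess_le (d : R) : 0 < d -> \forall n \near \oo,
  \sum_(i < n) (Num.min n%:R (s n i) - i%:R) <= d * n%:R ^+ 2.
Proof.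
move=> d0; have L0 := Nln_gt0; near=> n.
have [k [kn hk]] : exists k : 'I_n.+1, n%:R - k%:R <= d / 2 * n%:R /\
    expR (- ((c0 + 1) * n%:R + 1) - L * 'C(n, 2)%:R) <=
    \prod_(i < n) `|q ^+ k - x n i|.
  by near: n; apply: large_node; rewrite divr_gt0.
have hn : (c0 + 1) * n%:R + 1 <= (L * d / 2) * n%:R ^+ 2.
  by near: n; apply: near_linear_le_quadratic; rewrite divr_gt0// mulr_gt0.
have hprod : \prod_(i < n) `|q ^+ k - x n i| <=
    expR (- (L * \sum_(i < n) Num.min k%:R (s n i))).
  rewrite (reindex_inj rev_ord_inj)/= mulr_sumr -sumrN expR_sum.
  apply: ler_prod => i _; rewrite normr_ge0/=.
  rewrite (_ : (n - i.+1)%N = (n.-1 - i)%N); last by lia.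
  rewrite zero_expR// expr_expR.
  have m0 a b : a <= b -> `|expR (- (L * b)) - expR (- (L * a))| <= expR (- (L * a)) :> R.
    move=> ab; rewrite ler0_norm; first by rewrite opprB lerBlDr lerDl expR_ge0.
    by rewrite subr_le0 ler_expR lerN2 ler_wpM2l// ltW.
  by have [ks|/ltW sk] := leP k%:R (s n i); [rewrite distrC|]; exact: m0.
have {hprod hk} : L * \sum_(i < n) Num.min k%:R (s n i) <=
    (c0 + 1) * n%:R + 1 + L * 'C(n, 2)%:R.
  by have := le_trans hk hprod; rewrite ler_expR; lra.
move=> hs.
(* Raising the truncation from [k] to [n] costs at most [d / 2 * n] per zero; the other half of [d]
   pays for the linear error in [hs]. *)
have : \sum_(i < n) Num.min n%:R (s n i) <=
    \sum_(i < n) (Num.min k%:R (s n i) + d / 2 * n%:R).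
  apply: ler_sum => i _.
  have dn : 0 <= d / 2 * n%:R by rewrite mulr_ge0// divr_ge0// ltW.
  by have [?|?] := leP k%:R (s n i); have [?|?] := leP n%:R (s n i); lra.
rewrite big_split/= sumr_const card_ord -[_ *+ n]mulr_natl => hmin.
rewrite sumrB sum_nat_bin2 -(ler_pM2l L0).
have := ler_wpM2l (ltW L0) hmin; lra.
Unshelve. all: by end_near. Qed.

End lattice_polynomials.

(** * Averages of continuous functions *)

Lemma within_continuous_distP (R : realType) (A : set R) (f : R -> R) :
  {within A, continuous f} <->
  forall x, A x -> forall e, 0 < e -> exists2 d, 0 < d &
    forall y, A y -> `|x - y| < d -> `|f x - f y| < e.
Proof.
rewrite subspace_continuousP; split => [cf x Ax e e0|H x Ax].
  have /cvgrPdist_lt/(_ e e0) := cf x Ax.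
  rewrite near_withinE => /nbhs_ballP[d /= d0 dH].
  by exists d => // y Ay xy; exact: dH.
apply/cvgrPdist_lt => e e0; have [d d0 dH] := H x Ax e e0.
rewrite near_withinE; apply/nbhs_ballP; exists d => //= y xy Ay.
exact: dH.
Qed.

(** Heine's theorem; compactness enters in its near-covering form, along radii tending to 0 from the
    right. *)
Lemma segment_unif_continuous (R : realType) (a b : R) (f : R -> R) :
  {within `[a, b], continuous f} -> forall e, 0 < e -> exists2 d, 0 < d &
    forall x y, `[a, b]%classic x -> `[a, b]%classic y -> `|x - y| < d ->
      `|f x - f y| < e.
Proof.
move=> /within_continuous_distP cf e e0.
have /compact_near_coveringP/(_ R 0^'+ (fun d x => `[a, b]%classic x ->
    forall y, `[a, b]%classic y -> `|x - y| < d -> `|f x - f y| < e)) :=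
  @segment_compact R a b.
have e2 : 0 < e / 2 by rewrite divr_gt0.
case=> [x xab|d /= d0 H].
  have [d d0 dH] := cf x xab _ e2.
  have d2 : 0 < d / 2 by rewrite divr_gt0.
  exists (ball x (d / 2), [set t | t < d / 2]) => /=.
    by split; [exact: nbhsx_ballx|exact: nbhs_right_lt].
  move=> [z t]/= [xz td] zab y yab zy.
  rewrite /ball/= in xz.
  have h1 : `|f x - f z| < e / 2 by apply: dH => //; lra.
  have h2 : `|f x - f y| < e / 2.
    by apply: dH => //; have := ler_distD z x y; lra.
  by have := ler_distD (f x) (f z) (f y); rewrite [`|f z - f x|]distrC; lra.
exists (d / 2) => /=; first by rewrite divr_gt0.
move=> x y xab yab xy; apply: (H (d / 2)) => //; last by rewrite divr_gt0.
by rewrite /ball/= sub0r normrN gtr0_norm ?divr_gt0//; lra.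
Qed.

Lemma segment_bounded (R : realType) (a b : R) (f : R -> R) : a <= b ->
  {within `[a, b], continuous f} -> exists2 M, 0 <= M &
    forall x, `[a, b]%classic x -> `|f x| <= M.
Proof.
move=> ab cf.
have [c _ fc] := EVT_max ab cf; have [d _ fd] := EVT_min ab cf.
exists (`|f c| + `|f d|) => [|x xab]; first by rewrite addr_ge0.
have := fc x xab; have := fd x xab.
have := ler_norm (f c); have := ler_norm (- f d); rewrite normrN.
have := normr_ge0 (f c); have := normr_ge0 (f d).
by rewrite ler_norml => *; apply/andP; split; lra.
Qed.

(** With [F] the primitive of [f], the integral telescopes over cells of length [1 / n]; on each
    cell the mean value theorem and uniform continuity compare the increment of [F] with
    [f (i / n) / n]. *)
Lemma riemann_sum_cvg (R : realType) (f : R -> R) : {within `[0, 1], continuous f} ->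
  1 / n%:R * (\sum_(i < n) f (i%:R / n%:R)) @[n --> \oo] -->
  \int[lebesgue_measure]_(t in `[0, 1]) f t.
Proof.
move=> cf; set F := fun x => \int[lebesgue_measure]_(t in `[0, x]) f t.
have intf : lebesgue_measure.-integrable `[0, 1] (EFin \o f).
  by apply: continuous_compact_integrable => //; exact: segment_compact.
have cF : {within `[0, 1], continuous F}.
  exact: parameterized_integral_continuous.
have dF (x : R) : 0 < x -> x < 1 -> is_derive x 1 F (f x).
  move=> x0 x1; have [|dF F'] := continuous_FTC1_closed x1 intf x0.
    by apply: (within_continuous_continuous _ cf); rewrite ?in_itv/= ?x0 ?x1.
  by apply: DeriveDef => //; rewrite -derive1E.
apply/cvgrPdist_le => e e0.
have [d d0 dH] := @segment_unif_continuous R 0 1 f cf e e0.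
near=> n.
have n0 : (0 < n)%N by near: n; exact: nbhs_infty_gt.
have nR0 : 0 < n%:R :> R by rewrite ltr0n.
have nd : n%:R^-1 < d.
  rewrite invf_plt ?posrE//; near: n; exact: nbhs_infty_gtr.
have cell (i : 'I_n) :
    `|F (i.+1%:R / n%:R) - F (i%:R / n%:R) - f (i%:R / n%:R) / n%:R| <= e / n%:R.
  have i0 : 0 <= i%:R / n%:R :> R by rewrite divr_ge0.
  have i1 : i.+1%:R / n%:R <= 1 :> R by rewrite ler_pdivrMr// mul1r ler_nat.
  have ii : i%:R / n%:R < i.+1%:R / n%:R :> R by rewrite ltr_pM2r ?invr_gt0// ltr_nat.
  have dii : i.+1%:R / n%:R - i%:R / n%:R = n%:R^-1 :> R.
    by rewrite -mulrBl -natr1 addrAC subrr add0r mul1r.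
  have [c|c|] := @MVT R F f _ _ ii.
  - by rewrite in_itv/= => /andP[ic ci]; apply: dF; lra.
  - apply: (continuous_subspaceW _ cF) => z; rewrite /= !in_itv/= => /andP[? ?]; lra.
  - move=> c; rewrite in_itv/= => /andP[ic ci] ->; rewrite dii -mulrBl normrM.
    rewrite [X in _ * X]gtr0_norm ?invr_gt0// ler_pM2r ?invr_gt0// ltW//.
    apply: dH; rewrite /= ?in_itv/=; [lra|lra|].
    by rewrite gtr0_norm; lra.
have -> : \int[lebesgue_measure]_(t in `[0, 1]) f t = F (n%:R / n%:R) - F (0%:R / n%:R).
  by rewrite divff ?gt_eqF// mul0r {2}/F set_itv1 Rintegral_set1 subr0.
rewrite -(@telescope_sumr _ 0 n (fun i => F (i%:R / n%:R)))// big_mkord.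
rewrite mulrC mul1r mulr_suml -sumrB.
apply: (le_trans (ler_norm_sum _ _ _)).
apply: (@le_trans _ _ (\sum_(i < n) e / n%:R)); first by apply: ler_sum => i _; exact: cell.
by rewrite sumr_const card_ord -[_ *+ n]mulr_natr divfK// gt_eqF.
Unshelve. all: by end_near. Qed.

Lemma sum_small_index (R : realType) (c : R) n : 0 <= c ->
  \sum_(i < n) (i%:R < c)%R%:R <= c + 1.
Proof.
(* The induction needs the bound by [n] too: a new term equal to 1 means [n < c], and then
   [n + 1 <= c + 1]. *)
move=> c0; suff : \sum_(i < n) (i%:R < c)%R%:R <= Num.min n%:R (c + 1).
  by rewrite le_min => /andP[].
elim: n => [|n]; first by rewrite big_ord0 le_min lexx/= addr_ge0.
rewrite big_ord_recr/= !le_min -natr1 => /andP[h1 h2].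
by case: ltP => h /=; rewrite ?mulr1n ?mulr0n; apply/andP; split; lra.
Qed.

Lemma sum_large_index (R : realType) (c : R) n : 0 <= c ->
  \sum_(i < n) (n%:R - c < i%:R)%R%:R <= c + 1.
Proof.
move=> c0; rewrite (reindex_inj rev_ord_inj)/=.
apply: le_trans (@sum_small_index R c n c0).
apply: ler_sum => i _; rewrite natrB// -natr1.
by case: ltP => h1; case: ltP => h2; rewrite ?mulr1n ?mulr0n; lra.
Qed.

(* An index [i < n - eta n] either has [s n i / n] close to [i / n], or an excess
   of order [n], which can happen only [o(n)] times; the remaining indices are at
   most [eta n + 1]. *)
Lemma average_cvg0 (R : realType) (h : R -> R) (M : R) (s : nat -> nat -> R) :
  (forall u, 0 <= u -> `|h u| <= M) ->
  (forall e, 0 < e -> exists2 d, 0 < d & forall u v, 0 <= u -> 0 <= v ->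
     `|u - v| < d -> `|h u - h v| < e) ->
  (forall n i, (i < n)%N -> i%:R <= s n i) ->
  (forall d, 0 < d -> \forall n \near \oo,
     \sum_(i < n) (Num.min n%:R (s n i) - i%:R) <= d * n%:R ^+ 2) ->
  1 / n%:R * (\sum_(i < n) (h (s n i / n%:R) - h (i%:R / n%:R))) @[n --> \oo] --> (0 : R).
Proof.
move=> hM hu s_ge s_ex; apply/cvgrPdist_le => e e0.
have M0 : 0 <= M by rewrite (le_trans _ (hM 0 _)).
pose M' := M + 1.
have M'0 : 0 < M' by rewrite ltr_wpDl.
have e4 : 0 < e / 4 by rewrite divr_gt0.
have [d d0 dH] := hu _ e4.
(* The last [eta * n] indices, at a cost of [2 * M'] each, contribute [e / 4 * n]. *)
pose eta := e / (8 * M').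
have eta0 : 0 < eta by rewrite divr_gt0// mulr_gt0.
pose r := Num.min d eta.
have r0 : 0 < r by rewrite lt_min d0.
(* With this [K], an excess of [r * n] makes the second summand in [term] equal to the trivial bound
   [2 * M']. *)
pose K := 2 * M' / r.
have K0 : 0 < K by rewrite divr_gt0// mulr_gt0.
near=> n.
have n0 : (0 < n)%N by near: n; exact: nbhs_infty_gt.
have nR0 : 0 < n%:R :> R by rewrite ltr0n.
have nM : 8 * M' / e <= n%:R by near: n; exact: nbhs_infty_ger.
have ex : \sum_(i < n) (Num.min n%:R (s n i) - i%:R) <= e / (4 * K) * n%:R ^+ 2.
  by near: n; apply: s_ex; rewrite divr_gt0// mulr_gt0.
have term (i : 'I_n) : `|h (s n i / n%:R) - h (i%:R / n%:R)| <=
    e / 4 + K / n%:R * (Num.min n%:R (s n i) - i%:R) +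
    2 * M' * (n%:R - eta * n%:R < i%:R)%R%:R.
  have si := s_ge n i (ltn_ord i).
  have i0 : 0 <= i%:R / n%:R :> R by rewrite divr_ge0.
  have isn : i%:R / n%:R <= s n i / n%:R by rewrite ler_pM2r ?invr_gt0.
  have s0 : 0 <= s n i / n%:R by rewrite (le_trans i0).
  have ii : i%:R <= n%:R :> R by rewrite ler_nat ltnW.
  have mi : 0 <= Num.min n%:R (s n i) - i%:R by rewrite subr_ge0 le_min ii.
  have Kmi : 0 <= K / n%:R * (Num.min n%:R (s n i) - i%:R).
    by rewrite !mulr_ge0// ?invr_ge0 ltW.
  have bd : `|h (s n i / n%:R) - h (i%:R / n%:R)| <= 2 * M'.
    rewrite (le_trans (ler_normB _ _))// /M'.
    by have := hM _ s0; have := hM _ i0; lra.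
  have [big|notbig] := ltP (n%:R - eta * n%:R) i%:R; first by rewrite mulr1; lra.
  rewrite mulr0 addr0.
  have [close|far] := ltP `|s n i / n%:R - i%:R / n%:R| d.
    by have := dH _ _ s0 i0 close; lra.
  apply: (le_trans bd); apply: ler_wpDl; first exact: ltW.
  (* Being far gives an excess of at least [d * n] before truncation; if the truncation acts, [i]
     not being among the last indices leaves at least [eta * n]. *)
  have rn : r * n%:R <= Num.min n%:R (s n i) - i%:R.
    rewrite ger0_norm ?subr_ge0// -mulrBl ler_pdivlMr// in far.
    have rd : r <= d by rewrite ge_min lexx.
    have re : r <= eta by rewrite ge_min lexx orbT.
    have := ler_wpM2r (ltW nR0) rd; have := ler_wpM2r (ltW nR0) re.
    by have [?|?] := leP n%:R (s n i); lra.
  have -> : K / n%:R * (Num.min n%:R (s n i) - i%:R) =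
      2 * M' * ((Num.min n%:R (s n i) - i%:R) / (r * n%:R)).
    by rewrite /K; field; rewrite !gt_eqF.
  by rewrite ler_peMr ?mulr_ge0 ?(ltW M'0)// ler_pdivlMr ?mulr_gt0// mul1r.
rewrite sub0r normrN normrM ger0_norm ?divr_ge0// mul1r ler_pdivrMl//.
apply: (le_trans (ler_norm_sum _ _ _)).
apply: (le_trans (ler_sum _ (fun i _ => term i))).
rewrite !big_split/= sumr_const card_ord -[_ *+ n]mulr_natr -!mulr_sumr.
have hlarge := @sum_large_index R (eta * n%:R) n (ltW (mulr_gt0 eta0 nR0)).
have h1 : K / n%:R * \sum_(i < n) (Num.min n%:R (s n i) - i%:R) <= e / 4 * n%:R.
  apply: (le_trans (ler_wpM2l _ ex)); first by rewrite divr_ge0// ltW.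
  have -> : K / n%:R * (e / (4 * K) * n%:R ^+ 2) = e / 4 * n%:R; last by [].
  by field; rewrite !gt_eqF.
have h2 : 2 * M' * \sum_(i < n) (n%:R - eta * n%:R < i%:R)%R%:R <= e / 2 * n%:R.
  apply: (@le_trans _ _ (2 * M' * (eta * n%:R + 1))).
    by rewrite ler_wpM2l// mulr_ge0// ltW.
  have -> : 2 * M' * (eta * n%:R + 1) = e / 4 * n%:R + 2 * M'.
    by rewrite /eta; field; rewrite gt_eqF.
  by move: nM; rewrite ler_pdivrMr//; lra.
lra.
Unshelve. all: by end_near. Qed.

(** * Integrals against the empirical measures and the limit measure *)

Lemma ge0_integral_empirical (R : realType) (n : nat) (y : nat -> R) (D : set R)
    (f : R -> \bar R) : measurable D -> measurable_fun D f ->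
  (forall x, D x -> (0 <= f x)%E) -> (forall i, (i < n)%N -> D (y i)) ->
  (\int[empirical_measure n y]_(t in D) f t =
   n%:R^-1%:E * \sum_(i < n) f (y i))%E.
Proof.
move=> mD mf f0 Dy; rewrite /empirical_measure ge0_integral_mscale//=; congr (_ * _)%E.
rewrite ge0_integral_measure_sum//; apply: eq_bigr => i _.
by rewrite integral_dirac//= diracE mem_set ?mul1e//; exact: Dy.
Qed.

(** Positive and negative parts reduce this to [ge0_integral_empirical]. For [n = 0] both sides are
    0. *)
Lemma Rintegral_empirical (R : realType) (n : nat) (y : nat -> R) (g : R -> R) :
  {within `[0, 1], continuous g} ->
  (forall i, (i < n)%N -> `[0, 1]%classic (y i)) ->
  \int[empirical_measure n y]_(t in `[0, 1]) g t = n%:R^-1 * \sum_(i < n) g (y i).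
Proof.
move=> cg y01.
have mg : measurable_fun (`[0, 1]%classic : set R) (EFin \o g).
  by apply/measurable_EFinP; exact: subspace_continuous_measurable_fun.
rewrite /Rintegral integralE.
rewrite ge0_integral_empirical//; last exact: measurable_funepos.
rewrite ge0_integral_empirical//; last exact: measurable_funeneg.
have -> : (\sum_(i < n) (EFin \o g)^\+ (y i) = (\sum_(i < n) Num.max (g (y i)) 0)%:E)%E.
  by rewrite -sumEFin; apply: eq_bigr => i _; rewrite funepos.unlock/= EFin_max.
have -> : (\sum_(i < n) (EFin \o g)^\- (y i) = (\sum_(i < n) Num.max (- g (y i)) 0)%:E)%E.
  by rewrite -sumEFin; apply: eq_bigr => i _; rewrite funeneg.unlock/= EFin_max.
rewrite /= -mulrBr -sumrB; congr (_ * _); apply: eq_bigr => i _.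
by case: (leP (g (y i)) 0) => ?; case: (leP (- g (y i)) 0) => ?; lra.
Qed.

Section limit_measure.
Context (R : realType) (q : R).
Hypotheses (q0 : 0 < q) (q1 : q < 1).

Let mu := @lebesgue_measure R.
Let dens := nu_sigma_density q.

Lemma within_continuous_div_id (g : R -> R) : {within `[0, 1], continuous g} ->
  {within `[q, 1], continuous (fun t => g t / t)}.
Proof.
move=> cg; have cg' : {within `[q, 1], continuous g}.
  apply: (continuous_subspaceW _ cg) => t; rewrite /= !in_itv/= => /andP[qt ->].
  by rewrite andbT (le_trans (ltW q0)).
have ci : {within `[q, 1], continuous (fun t : R => t^-1)}.
  apply: continuous_in_subspaceT => u; rewrite inE/= in_itv/= => /andP[qu _].
  by apply: inv_continuous; rewrite gt_eqF// (lt_le_trans q0).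
by move=> t; apply: cvgM; [exact: cg'|exact: ci].
Qed.

Lemma integrable_div_id (g : R -> R) : {within `[0, 1], continuous g} ->
  mu.-integrable `[q, 1] (EFin \o (fun t => g t / t)).
Proof.
move=> cg; apply: continuous_compact_integrable; first exact: segment_compact.
exact: within_continuous_div_id.
Qed.

Lemma integral_nu_sigma_density (g : R -> R) :
  (\int[mu]_(t in `[0%R, 1%R]) ((g t)%:E * (dens t)%:E) =
   \int[mu]_(t in `[q, 1%R]) (-1 / ln q * (g t / t))%:E)%E.
Proof.
rewrite integral_mkcond [RHS]integral_mkcond; apply: eq_integral => t _.
rewrite !patchE.
have [t1|t1] := boolP (t \in `[q, 1]%classic); move: (t1).
  rewrite inE/= in_itv/= => qt1; rewrite mem_set/=; last first.
    by rewrite in_itv/=; case/andP: qt1 => qt ->; rewrite andbT (le_trans (ltW q0)).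
  by rewrite /dens /nu_sigma_density qt1 -EFinM; congr EFin; ring.
case: ifP => // _; rewrite notin_setE/= in_itv/= => /negP/negbTE qt1.
by rewrite /dens /nu_sigma_density qt1 mule0.
Qed.

Lemma integrable_nu_sigma_density : mu.-integrable setT (EFin \o dens).
Proof.
have c1 : {within `[0 : R, 1], continuous (fun _ : R => 1 : R)}.
  by apply: continuous_subspaceT => ?; exact: cvg_cst.
rewrite (_ : EFin \o dens =
    (EFin \o (fun t => -1 / ln q * (1 / t))) \_ `[q, 1]).
  apply: (proj1 (@integrable_mkcond _ _ _ mu `[q, 1] _ (measurable_itv _))).
  have := integrable_div_id _ c1; move/(@integrableZl _ _ _ mu `[q, 1] (measurable_itv _) (-1 / ln q)).
  by congr (integrable _ _ _); apply/funext => t; rewrite /= EFinM.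
apply/funext => t; rewrite patchE /dens /nu_sigma_density/=.
have -> : (t \in `[q, 1]%classic) = (q <= t <= 1).
  by apply/idP/idP => [|h]; rewrite inE/= in_itv.
by case: ifP.
Qed.

Lemma fin_num_nu_sigma : fin_num_fun (nu_sigma q).
Proof.
move=> A mA; rewrite /nu_sigma.
have /integrableP[_] := integrable_nu_sigma_density.
rewrite ge0_fin_numE; last first.
  by apply: integral_ge0 => t _; rewrite lee_fin nu_sigma_density_ge0.
apply: le_lt_trans.
have md : measurable_fun setT (EFin \o dens).
  by apply/measurable_EFinP; exact: measurable_nu_sigma_density.
have -> : (\int[mu]_(t in A) (dens t)%:E = \int[mu]_(t in A) `|(EFin \o dens) t|)%E.
  by apply: eq_integral => t _; rewrite /= ger0_norm// nu_sigma_density_ge0.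
apply: ge0_subset_integral => //.
exact: measurableT_comp.
Qed.

(* The Lebesgue measure lives on [measurableTypeR R] whereas [nu_sigma] lives on
   [R] itself; both carry the same sigma-algebra, and [idTR] relates them. *)
Let nu : set (measurableTypeR R) -> \bar R := nu_sigma q.

Let nu_additive : semi_sigma_additive nu.
Proof. exact: (@measure_semi_sigma_additive _ _ _ (nu_sigma q)). Qed.

HB.instance Definition _ := isMeasure.Build _ _ _ nu
  (measure0 (nu_sigma q)) (measure_ge0 (nu_sigma q)) nu_additive.

Let nu_fin : fin_num_fun nu.
Proof. exact: fin_num_nu_sigma. Qed.

HB.instance Definition _ := @Measure_isFinite.Build _ _ _ nu nu_fin.

(** The measure is finite and absolutely continuous, so the integral is that of [g] times a
    Radon-Nikodym derivative, which agrees almost everywhere with the explicit density. *)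
Lemma Rintegral_nu_sigma (g : R -> R) : {within `[0, 1], continuous g} ->
  \int[nu_sigma q]_(t in `[0, 1]) g t =
  -1 / ln q * \int[mu]_(t in `[q, 1]) (g t / t).
Proof.
move=> cg.
have mg : measurable_fun (`[0, 1]%classic : set R) g.
  exact: subspace_continuous_measurable_fun.
have md : measurable_fun (setT : set (measurableTypeR R)) (EFin \o dens).
  by apply/measurable_EFinP; exact: measurable_nu_sigma_density.
have mg' : measurable_fun (`[0, 1]%classic : set (measurableTypeR R)) (EFin \o g).
  exact/measurable_EFinP.
have m01 : measurable (`[0, 1]%classic : set (measurableTypeR R)) by exact: measurable_itv.
have dom : nu `<< mu.
  apply/null_content_dominatesP => A mA A0.
  apply: null_set_integral => //; exact: measurable_funTS.
have [M M0 hM] := @segment_bounded R 0 1 g ler01 cg.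
have bg : [bounded g t | t in `[0, 1]%classic].
  exists M; split; first exact: num_real.
  by move=> r Mr t /= t01; rewrite (le_trans (hM t t01))// ltW.
have ig : nu.-integrable `[0, 1] (EFin \o g).
  apply: measurable_bounded_integrable => //.
    by rewrite ltey_eq fin_num_measure.
have -> : \int[nu_sigma q]_(t in `[0, 1]) g t = \int[nu]_(t in `[0, 1]) g t.
  pose idTR : measurableTypeR R -> R := idfun.
  have mid : measurable_fun setT idTR by exact: measurable_id.
  congr fine; rewrite integral_mkcond [RHS]integral_mkcond.
  set f := (EFin \o g) \_ _.
  have mf : measurable_fun (setT : set R) f.
    by apply/(measurable_restrictT _ _).1 => //; exact/measurable_EFinP.
  have if_ : nu.-integrable setT (f \o idTR).
    exact/(integrable_mkcond _ m01).
  rewrite -[RHS](integral_pushforward mid mf if_ measurableT).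
  exact: eq_measure_integral.
rewrite /Rintegral -(Radon_Nikodym_change_of_variables dom)//.
(* Equal integrals over every measurable subset force equality almost everywhere. *)
have ae : ae_eq mu (`[0, 1]%classic : set (measurableTypeR R)) (Radon_Nikodym (charge_of_finite_measure nu) mu) (EFin \o dens).
  apply: integral_ae_eq => //.
  - apply: (integrableS measurableT) => //; exact: Radon_Nikodym_integrable.
  - exact: measurable_funTS.
  - by move=> A A01 mA; rewrite -Radon_Nikodym_integral.
transitivity (fine (\int[mu]_(t in `[0%R, 1%R]) ((g t)%:E * (dens t)%:E))%E).
  congr fine; apply: ae_eq_integral => //.
  - apply: emeasurable_funM => //.
    apply: measurable_funTS; apply: measurable_int; exact: Radon_Nikodym_integrable.
  - by apply: emeasurable_funM => //; exact: measurable_funTS.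
  - exact: ae_eqe_mul2l.
rewrite integral_nu_sigma_density.
rewrite -[LHS]/(\int[mu]_(t in `[q, 1]) (-1 / ln q * (g t / t))).
by rewrite RintegralZl//; exact: integrable_div_id.
Qed.

End limit_measure.

(** * The substitution [t = expR (- (L * u))] *)

Section exponential_substitution.
Context (R : realType) (L : R) (g : R -> R).
Hypotheses (L_gt0 : 0 < L) (cg : {within `[0, 1], continuous g}).

Let F (u : R) : R := expR (- (L * u)).
Let h (u : R) : R := g (F u).

Lemma expNM_itv u : 0 <= u -> `[0, 1]%classic (F u).
Proof.
move=> u0; rewrite /= in_itv/= expR_ge0 -[X in _ <= X]expR0 ler_expR.
by rewrite oppr_le0 mulr_ge0// ltW.
Qed.

(** Factoring out [F u], which is at most 1, leaves [1 - expR (- a)] with [a = L * (v - u)], and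
    this is at most [a]. *)
Lemma expNM_lipschitz u v : 0 <= u -> 0 <= v -> `|F u - F v| <= L * `|u - v|.
Proof.
wlog uv : u v / u <= v => [H|].
  by case: (leP u v) => [|/ltW] uv *; [exact: H|rewrite distrC (distrC u) H].
move=> u0 v0; rewrite ger0_norm; last first.
  by rewrite subr_ge0 ler_expR lerN2 ler_pM2l.
rewrite (distrC u) ger0_norm ?subr_ge0//.
have -> : F v = F u * expR (- (L * (v - u))).
  by rewrite /F -expRD; congr expR; ring.
have F1 : F u <= 1 by have := expNM_itv u u0; rewrite /= in_itv/= => /andP[].
have F0 : 0 < F u by exact: expR_gt0.
have := expR_ge1Dx (- (L * (v - u))).
have : 0 <= L * (v - u) by rewrite mulr_ge0 ?subr_ge0 ?(ltW L_gt0).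
set a := L * _; set b := expR (- a); nra.
Qed.

Lemma comp_expNM_bounded : exists M, forall u, 0 <= u -> `|h u| <= M.
Proof.
have [M _ hM] := @segment_bounded R 0 1 g ler01 cg.
by exists M => u u0; apply: hM; exact: expNM_itv.
Qed.

(** The half-line is covered because [F] is Lipschitz with values in the compact [[0, 1]], where [g]
    is uniformly continuous. A bounded range of [u] would not do: the exponents of the zeros have no
    upper bound here. *)
Lemma comp_expNM_unif_continuous e : 0 < e -> exists2 d, 0 < d &
  forall u v, 0 <= u -> 0 <= v -> `|u - v| < d -> `|h u - h v| < e.
Proof.
move=> e0; have [d d0 dH] := @segment_unif_continuous R 0 1 g cg e e0.
exists (d / L) => [|u v u0 v0 uv]; first exact: divr_gt0.
apply: dH; [exact: expNM_itv|exact: expNM_itv|].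
by rewrite (le_lt_trans (expNM_lipschitz _ _ u0 v0))// mulrC -ltr_pdivlMr.
Qed.

Lemma comp_expNM_continuous : {within `[0, 1], continuous h}.
Proof.
apply/within_continuous_distP => u; rewrite /= in_itv/= => /andP[u0 _] e e0.
have [d d0 dH] := comp_expNM_unif_continuous e e0; exists d => // v.
by rewrite /= in_itv/= => /andP[v0 _]; exact: dH.
Qed.

(** Here [dt / t = - L du], and the orientation is reversed, hence the factor [L]. *)
Lemma Rintegral_expNM :
  \int[lebesgue_measure]_(t in `[expR (- L), 1]) (g t / t) =
  L * \int[lebesgue_measure]_(u in `[0, 1]) h u.
Proof.
have dF u : is_derive u (1 : R) F (- L * F u).
  rewrite mulrC; apply: (@is_derive1_comp _ expR (fun u => - (L * u))).
  by apply: is_derive_eq; rewrite /GRing.scale/=; ring.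
have F'E : derive1 F = fun u => - L * F u.
  by apply/funext => u; rewrite derive1E derive_val.
have cF : continuous F.
  by move=> u; apply: differentiable_continuous; apply/derivable1_diffP.
have cF' : continuous (derive1 F).
  by rewrite F'E => u; apply: cvgM; [exact: cvg_cst|exact: cF].
have F1 : F 1 = expR (- L) by rewrite /F mulr1.
have F0 : F 0 = 1 by rewrite /F mulr0 oppr0 expR0.
have FL : expR (- L) < 1 by rewrite expR_lt1 oppr_lt0.
have := @integration_by_substitution_decreasing R F (fun t => g t / t) 0 1 ler01.
rewrite F1 F0 /Rintegral => ->.
- rewrite -[RHS]RintegralZl//; last first.
    by apply: continuous_compact_integrable; [exact: segment_compact|exact: comp_expNM_continuous].
  congr fine; apply: eq_integral => u _; rewrite /= F'E; congr EFin.
  rewrite -[LHS]/(h u / F u * - (- L * F u)).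
  by field; rewrite gt_eqF// expR_gt0.
- by move=> u v _ _ uv; rewrite ltr_expR ltrN2 ltr_pM2l.
- by move=> u _; exact: cF'.
- by apply/cvg_ex; exists (derive1 F 0); apply: cvg_at_right_filter; exact: cF'.
- by apply/cvg_ex; exists (derive1 F 1); apply: cvg_at_left_filter; exact: cF'.
- by split => //; [apply: cvg_at_right_filter; exact: cF|apply: cvg_at_left_filter; exact: cF].
- apply: within_continuous_div_id => //; exact: expR_gt0.
Qed.

End exponential_substitution.

Theorem theorem2p2 (R : realType) (q : R) (w : R -> R)
    (p : nat -> {poly R}) (x : nat -> nat -> R)
    (hq0 : 0 < q) (hq1 : q < 1)
    (hw : forall t : R, 0 < t -> t <= 1 -> 0 < w t)
    (hsum : cvgn (series (fun k : nat => q ^+ k * w (q ^+ k))))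
    (hdeg : forall n : nat, size (p n) = n.+1)
    (hlead : forall n : nat, 0 < lead_coef (p n))
    (hortho : orthonormal_on_lattice q w p)
    (hzeros : forall n : nat, increasing_zeros (p n) n (x n))
    (hlim : forall a b : R, 0 < a -> a < b -> b <= 1 ->
      {uniform `[a, b],
        (fun (n : nat) (t : R) => 1 / n%:R ^+ 2 * ln (w (t ^+ n))) @ \oo
        --> (fun _ : R => 0 : R)}) :
  [/\ lead_coef (p n) `^ (1 / n%:R ^+ 2) @[n --> \oo] --> q `^ (- (1 / 2)),
      weak_cvg01
        (fun n : nat => empirical_measure n (fun j => x n j `^ (1 / n%:R)))
        (nu_sigma q)
    & forall g : R -> R, {within `[0, 1], continuous g} ->
        1 / n%:R * (\sum_(j < n) g (x n j `^ (1 / n%:R))) @[n --> \oo]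
        --> -1 / ln q * \int[lebesgue_measure]_(t in `[q, 1]) (g t / t)].
Proof.
have L0 : 0 < - ln q by exact: Nln_gt0.
pose s (n i : nat) : R := - ln (x n (n.-1 - i)%N) / - ln q.
have root_exp n i : (i < n)%N ->
    x n (n.-1 - i)%N `^ (1 / n%:R) = expR (- (- ln q * (s n i / n%:R))).
  move=> ltin; have xE := zero_expR R q w p x hq0 hq1 hw hdeg hlead hortho hzeros n i ltin.
  rewrite xE /powR gt_eqF ?expR_gt0// expRK /s; congr expR; ring.
(* The last conclusion comes first, since weak convergence is read off from it. *)
have roots (g : R -> R) : {within `[0, 1], continuous g} ->
    1 / n%:R * (\sum_(j < n) g (x n j `^ (1 / n%:R))) @[n --> \oo]
        --> -1 / ln q * \int[lebesgue_measure]_(t in `[q, 1]) (g t / t).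
  move=> cg; pose h u := g (expR (- (- ln q * u))).
  have -> : -1 / ln q * \int[lebesgue_measure]_(t in `[q, 1]) (g t / t) =
      \int[lebesgue_measure]_(u in `[0, 1]) h u.
    have := Rintegral_expNM R (- ln q) g L0 cg.
    rewrite opprK lnK ?posrE// => ->.
    by rewrite mulrA -[X in _ = X]mul1r; congr (_ * _); field; rewrite -oppr_eq0 gt_eqF.
  (* The average is split into a Riemann sum of [h] and the deviation caused by the excess of
     [s n i] over [i]. *)
  have -> : (fun n => 1 / n%:R * (\sum_(j < n) g (x n j `^ (1 / n%:R)))) =
      fun n => 1 / n%:R * (\sum_(i < n) (h (s n i / n%:R) - h (i%:R / n%:R))) +
               1 / n%:R * (\sum_(i < n) h (i%:R / n%:R)).
    apply/funext => n; rewrite -mulrDr -big_split/=; congr (_ * _).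
    rewrite (reindex_inj rev_ord_inj)/=; apply: eq_bigr => i _.
    rewrite subrK (_ : (n - i.+1)%N = (n.-1 - i)%N); last by lia.
    by rewrite root_exp.
  rewrite -[X in _ --> X]add0r; apply: cvgD.
    have [M hM] := comp_expNM_bounded R (- ln q) g L0 cg.
    apply: (average_cvg0 R h M) => //.
    - exact: comp_expNM_unif_continuous.
    - exact: (log_zero_ge R q w p x hq0 hq1 hw hdeg hlead hortho hzeros).
    - exact: (truncated_excess_le R q w p x hq0 hq1 hw hsum hdeg hlead hortho hzeros hlim).
  by apply: riemann_sum_cvg; exact: comp_expNM_continuous.
split => //; first exact: (cvg_lead_coef R q w p hq0 hq1 hw hsum hdeg hlead hortho hlim).
move=> g cg; rewrite Rintegral_nu_sigma//.
suff E n : \int[empirical_measure n (fun j => x n j `^ (1 / n%:R))]_(t in `[0, 1]) g t =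
    1 / n%:R * (\sum_(j < n) g (x n j `^ (1 / n%:R))).
  by under eq_fun do rewrite E; exact: roots.
rewrite Rintegral_empirical//; first by rewrite div1r.
move=> i ltin /=.
(* The facts on [s] count from the largest zero, so [i] is written as a reversed index. *)
have -> : i = (n.-1 - (n.-1 - i))%N by lia.
rewrite root_exp; last by lia.
apply: expNM_itv => //; rewrite divr_ge0// (le_trans (ler0n _ (n.-1 - i)))//.
apply: (log_zero_ge R q w p x hq0 hq1 hw hdeg hlead hortho hzeros); lia.
Qed.
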